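(* Let $R = R_1\times\cdots\times R_r$ be a finite direct product of finite chain rings, let $E$ be the set of representatives of the ideals of $R$ (described in the context), and let $w : R\to\mathbb{C}$ be an invariant weight, i.e. $w(0)=0$ and $w(ux)=w(x)=w(xu)$ for all $x\in R$, $u\in R^\times$. If $$\sum_{t\in E,\ x^{\bot}\le t}\mu(0,Rxt)\,w(tx)\neq 0\qquad\text{for all } x\in E\setminus\{0\},$$ then MacWilliams' Equivalence Theorem holds for $w$ on $R$: for every positive integer $n$, every linear code $C\subseteq {}_RR^n$ and every linear $w$-isometry $\phi: C\to {}_RR^n$, there exists a ${\rm Sym}_r(w)$-monomial transformation of $R^n$ which extends $\phi$.
   Context: Rings are finite, associative, with identity $1$; $R^\times$ is the group of units of $R$. A ring is a chain ring if its left ideals form a chain under inclusion and its right ideals form a chain under inclusion. Setting: $R=R_1\times\cdots\times R_r$ with each $R_i$ a finite chain ring, whose Jacobson radical is generated by $p_i$ and has nilpotency index $d_i$. Operations are componentwise. For integers $0\le e_i\le d_i$ write $p_1^{e_1}\cdots p_r^{e_r}$ for the element $(p_1^{e_1},\dots,p_r^{e_r})\in R$ (with $p_i^0=1$). Let $E=\{p_1^{e_1}\cdots p_r^{e_r} \mid 0\le e_i\le d_i\}$; the principal left ideals of $R$ are exactly the $Re$, $e\in E$, and distinct exponent tuples give distinct ideals. For $e=p_1^{e_1}\cdots p_r^{e_r}$ and $f=p_1^{f_1}\cdots p_r^{f_r}$ in $E$, write $f\le e$ if $Rf\subseteq Re$, equivalently $e_i\le f_i$ for all $i$. For $x=p_1^{x_1}\cdots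 p_r^{x_r}\in E$ set $x^\bot=p_1^{d_1-x_1}\cdots p_r^{d_r-x_r}\in E$ (it generates the annihilator of $Rx$). $\mu$ is the Möbius function of the poset of principal left ideals of $R$ ordered by inclusion: $\mu(I,I)=1$, $\mu(I,J)=-\sum_{I\le K<J}\mu(I,K)$ for $I<J$, and $\mu(I,J)=0$ if $I\not\le J$; here $0$ denotes the zero ideal. A weight $w:R\to\mathbb{C}$ is a function with $w(0)=0$, extended to $R^n$ by $w(x_1,\dots,x_n)=\sum_i w(x_i)$. ${\rm Sym}_r(w)=\{u\in R^\times \mid w(xu)=w(x)\ \forall x\in R\}$. A linear code of length $n$ is a left $R$-submodule $C$ of ${}_RR^n$. A linear $w$-isometry $\phi:C\to{}_RR^n$ is a left $R$-module homomorphism with $w(\phi(x))=w(x)$ for all $x\in C$. For a subgroup $G\le R^\times$, a $G$-monomial transformation of $R^n$ is a map $(x_1,\dots,x_n)\mapsto(x_{\pi(1)}u_1,\dots,x_{\pi(n)}u_n)$ with $\pi$ a permutation of $\{1,\dots,n\}$ and $u_1,\dots,u_n\in G$. *)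

(* Defs.v *)
From HB Require Import structures.
From mathcomp Require Import all_boot all_order all_fingroup all_algebra.
From mathcomp Require Import complex.
From mathcomp Require Import reals.

Set Implicit Arguments.
Unset Strict Implicit.
Unset Printing Implicit Defensive.

Import GRing.Theory.
Local Open Scope ring_scope.

(* MathComp only puts a ring structure on non-dependent finite functions. The
   indices range over 'I_r.+1 because a MathComp unit ring satisfies 1 != 0. *)
Section ProductRing.
Variables (r : nat) (R_ : 'I_r.+1 -> finUnitRingType).

Definition prodring : Type := {dffun forall i, R_ i}.
HB.instance Definition _ := Finite.on prodring.

Definition prod_fun (x : prodring) : forall i, R_ i :=
  fun i => (x : {dffun forall i, R_ i}) i.
Coercion prod_fun : prodring >-> Funclass.

Definition mkprod (f : forall i, R_ i) : prodring := [ffun i => f i].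

Lemma mkprodE f i : mkprod f i = f i.
Proof. by rewrite /mkprod /prod_fun ffunE. Qed.

Lemma prodP (x y : prodring) : (forall i, x i = y i) <-> x = y.
Proof. by split=> [e | -> //]; apply/ffunP=> i; apply: e. Qed.

Definition prod_zero := mkprod (fun=> 0).
Definition prod_one := mkprod (fun=> 1).
Definition prod_opp (x : prodring) := mkprod (fun i => - x i).
Definition prod_add (x y : prodring) := mkprod (fun i => x i + y i).
Definition prod_mul (x y : prodring) := mkprod (fun i => x i * y i).
Definition prod_unit : pred prodring :=
  fun x => [forall i, x i \is a GRing.unit].
Definition prod_inv (x : prodring) : prodring :=
  if prod_unit x then mkprod (fun i => (x i)^-1) else x.

Fact prod_addA : associative prod_add.
Proof. by move=> x y z; apply/prodP=> i; rewrite !mkprodE addrA. Qed.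
Fact prod_addC : commutative prod_add.
Proof. by move=> x y; apply/prodP=> i; rewrite !mkprodE addrC. Qed.
Fact prod_add0 : left_id prod_zero prod_add.
Proof. by move=> x; apply/prodP=> i; rewrite !mkprodE add0r. Qed.
Fact prod_addN : left_inverse prod_zero prod_opp prod_add.
Proof. by move=> x; apply/prodP=> i; rewrite !mkprodE addNr. Qed.

HB.instance Definition _ :=
  GRing.isZmodule.Build prodring prod_addA prod_addC prod_add0 prod_addN.

Fact prod_mulA : associative prod_mul.
Proof. by move=> x y z; apply/prodP=> i; rewrite !mkprodE mulrA. Qed.
Fact prod_mul1l : left_id prod_one prod_mul.
Proof. by move=> x; apply/prodP=> i; rewrite !mkprodE mul1r. Qed.
Fact prod_mul1r : right_id prod_one prod_mul.
Proof. by move=> x; apply/prodP=> i; rewrite !mkprodE mulr1. Qed.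
Fact prod_mulDl : left_distributive prod_mul prod_add.
Proof. by move=> x y z; apply/prodP=> i; rewrite !mkprodE mulrDl. Qed.
Fact prod_mulDr : right_distributive prod_mul prod_add.
Proof. by move=> x y z; apply/prodP=> i; rewrite !mkprodE mulrDr. Qed.
Fact prod_one_neq0 : prod_one != prod_zero.
Proof.
apply/eqP=> /prodP /(_ ord0) /eqP.
by rewrite !mkprodE oner_eq0.
Qed.

HB.instance Definition _ :=
  GRing.Zmodule_isNzRing.Build prodring
    prod_mulA prod_mul1l prod_mul1r prod_mulDl prod_mulDr prod_one_neq0.

Fact prod_mulVx : {in prod_unit, left_inverse 1 prod_inv *%R}.
Proof.
move=> x Ux; rewrite /prod_inv ifT //; apply/prodP=> i; rewrite !mkprodE.
by rewrite mulVr //; apply: (forallP Ux).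
Qed.
Fact prod_mulxV : {in prod_unit, right_inverse 1 prod_inv *%R}.
Proof.
move=> x Ux; rewrite /prod_inv ifT //; apply/prodP=> i; rewrite !mkprodE.
by rewrite mulrV //; apply: (forallP Ux).
Qed.
Fact prod_unitP (x y : prodring) : y * x = 1 /\ x * y = 1 -> prod_unit x.
Proof.
case=> /prodP yx /prodP xy; apply/forallP=> i; apply/unitrP; exists (y i).
by have := yx i; have := xy i; rewrite !mkprodE.
Qed.
Fact prod_inv_out : {in [predC prod_unit], prod_inv =1 id}.
Proof. by move=> x nUx; rewrite /prod_inv ifN. Qed.

HB.instance Definition _ :=
  GRing.NzRing_hasMulInverse.Build prodring
    prod_mulVx prod_mulxV prod_unitP prod_inv_out.

End ProductRing.

Section Ideals.
Variable A : finNzRingType.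
Implicit Types (I J : {set A}) (x : A).

Definition left_ideal I : bool :=
  [&& 0 \in I, [forall x in I, forall y in I, x + y \in I]
    & [forall a, forall x in I, a * x \in I]].

Definition right_ideal I : bool :=
  [&& 0 \in I, [forall x in I, forall y in I, x + y \in I]
    & [forall a, forall x in I, x * a \in I]].

Definition chain_ring : Prop :=
  (forall I J, left_ideal I -> left_ideal J -> (I \subset J) || (J \subset I)) /\
  (forall I J, right_ideal I -> right_ideal J -> (I \subset J) || (J \subset I)).

Definition lideal x : {set A} := [set a * x | a : A].

Definition principal_lideals : {set {set A}} := [set lideal x | x : A].

Definition jacobson : {set A} :=
  \bigcap_(M : {set A} | maxset (fun I => left_ideal I && (I != setT)) M) M.

(* J ^ k = 0, i.e. all k-fold products of elements of J vanish *)
Definition pow_eq0 J (k : nat) : Prop :=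
  forall x : 'I_k -> A, (forall i, x i \in J) -> \prod_(i < k) x i = 0.

Definition nilpotency_index J (k : nat) : Prop :=
  pow_eq0 J k /\ (forall m, pow_eq0 J m -> (k <= m)%N).

End Ideals.

Section Moebius.
Variables (T : finType) (P : {set {set T}}).
Implicit Types I J K : {set T}.

Fixpoint moebius_rec (n : nat) I J : int :=
  if I == J then 1 else
  if I \proper J then
    if n is n'.+1 then
      - \sum_(K in P | (I \subset K) && (K \proper J)) moebius_rec n' I K
    else 0
  else 0.

(* The Moebius function of P ordered by inclusion; #|J| is enough recursion
   depth, see moebius_lt. *)
Definition moebius I J : int := moebius_rec #|J| I J.

Lemma moebius_rec_enough n I J :
  (#|J| <= n)%N -> moebius_rec n I J = moebius I J.
Proof.
rewrite /moebius; have [m] := ubnP #|J|.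
elim: m n J => // m IHm n J /ltnSE-leJm leJn.
case: n leJn => [|n]; first by rewrite leqn0 => /eqP->.
case EJ: #|J| => [|j] leJn.
  have -> : J = set0 by apply/eqP; rewrite -cards_eq0 EJ.
  by rewrite /= properE sub0set andbF.
rewrite /=; case: ifP => // _; case: ifP => // _; congr (- _).
apply: eq_bigr => K /and3P[_ _ /proper_card]; rewrite EJ ltnS => leKj.
have ltKm : (#|K| < m)%N by apply: leq_ltn_trans leKj _; rewrite -EJ.
by rewrite (IHm n) ?(IHm j) // (leq_trans leKj).
Qed.

Lemma moebius_refl I : moebius I I = 1.
Proof. by rewrite /moebius; case: #|I| => [|n] /=; rewrite eqxx. Qed.

Lemma moebius_lt I J : I \proper J ->
  moebius I J =
    - \sum_(K in P | (I \subset K) && (K \proper J)) moebius I K.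
Proof.
move=> ltIJ; rewrite {1}/moebius.
have := proper_card ltIJ; case EJ: #|J| => [//|j] _ /=.
rewrite ltIJ; case: eqP ltIJ => [->|_ _]; first by rewrite properxx.
congr (- _); apply: eq_bigr => K /and3P[_ _ /proper_card].
by rewrite EJ ltnS; apply: moebius_rec_enough.
Qed.

Lemma moebius_nle I J : ~~ (I \subset J) -> moebius I J = 0.
Proof.
move=> nIJ; have neIJ : I == J = false.
  by apply: contraNF nIJ => /eqP->.
have nltIJ : I \proper J = false by rewrite properE (negPf nIJ).
by rewrite /moebius; case: #|J| => [|n] /=; rewrite neIJ nltIJ.
Qed.

End Moebius.

Section Exponents.
Variables (r : nat) (R_ : 'I_r.+1 -> finUnitRingType).
Variables (p : forall i, R_ i) (d : 'I_r.+1 -> nat).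

Definition exponents : Type := {dffun forall i : 'I_r.+1, 'I_(d i).+1}.
HB.instance Definition _ := Finite.on exponents.

Definition ppow (e : exponents) : prodring R_ :=
  mkprod (fun i => p i ^+ (e : {dffun _}) i).

Definition representatives : {set prodring R_} := [set ppow e | e : exponents].

(* rev_ord : 'I_(d i).+1 -> 'I_(d i).+1 maps k to d i - k *)
Definition perp (e : exponents) : exponents :=
  [ffun i => rev_ord ((e : {dffun _}) i)].

End Exponents.

Section Codes.
Variables (R : finUnitRingType) (V : nmodType).
Implicit Types (w : R -> V) (n : nat).

Definition invariant_weight w : Prop :=
  w 0 = 0 /\
  (forall x u, u \is a GRing.unit -> w (u * x) = w x /\ w x = w (x * u)).

Definition weight w n (x : 'rV[R]_n) : V := \sum_(i < n) w (x 0 i).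

Definition right_sym w : {set {unit R}} :=
  [set u | [forall x, w (x * val u) == w x]].

Fact right_sym_group_set w : group_set (right_sym w).
Proof.
apply/group_setP; split=> [|u v]; rewrite !inE.
  by apply/forallP=> x; rewrite mulr1.
move=> /forallP wu /forallP wv; apply/forallP=> x.
by rewrite mulrA (eqP (wv _)) (eqP (wu _)).
Qed.
Canonical right_sym_group w := Group (right_sym_group_set w).

Definition linear_isometry w n (C : {set 'rV[R]_n})
    (phi : 'rV[R]_n -> 'rV[R]_n) : Prop :=
  (forall a, {in C &, forall x y, phi (a *: x + y) = a *: phi x + phi y}) /\
  {in C, forall x, weight w (phi x) = weight w x}.

Definition monomial (G : {group {unit R}}) n (T : 'rV[R]_n -> 'rV[R]_n) : Prop :=
  exists (s : 'S_n) (u : 'I_n -> {unit R}),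
    (forall i, u i \in G) /\
    (forall x, T x = \row_(i < n) (x 0 (s i) * val (u i))).

(* The values of phi outside C are irrelevant. *)
Definition MacWilliams_equivalence w : Prop :=
  forall n, (0 < n)%N ->
  forall C : {set 'rV[R]_n}, submod_closed C ->
  forall phi : 'rV[R]_n -> 'rV[R]_n, linear_isometry w C phi ->
  exists T : 'rV[R]_n -> 'rV[R]_n,
    monomial (right_sym_group w) T /\ {in C, T =1 phi}.

End Codes.

(* Main.v *)
Require Import Defs.
From HB Require Import structures.
From mathcomp Require Import all_boot all_order all_fingroup all_algebra.
From mathcomp Require Import complex.
From mathcomp Require Import reals.
From mathcomp Require Import all_field all_character zify.
Set Implicit Arguments.
Unset Strict Implicit.
Unset Printing Implicit Defensive.
Import GRing.Theory Num.Theory.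
Local Open Scope ring_scope.

(** An invariant weight has all of R^x as right symmetry group, so the theorem
    asks for a permutation that carries each coordinate function of phi to a
    coordinate function of the code C, up to a right unit factor.

    Every element of R is p^e u for an exponent vector e and a unit u
    ([right_factorization]), so w is a function W of exponent vectors, and a
    product of elements truncates the sum of their exponent vectors.  For x in C
    let N f be the number of coordinates of phi x with exponent vector f, minus
    the same number for x.  Applying the isometry to the codewords p^t x gives
    sum_f N f W (t + f) = 0 for all t.  Combining these equations with the
    coefficients mu(0, R p^x p^t), where p^t divides the annihilator generator
    of p^x, gives sum_f N f T_x(f) = 0, where T_x(x) is the number that the
    theorem assumes to be nonzero.  Moreover T_x(f) = 0 unless f <= x
    coordinatewise ([mobius_transform_eq0]): mu(0, -) is the product of the
    Moebius functions of chains ([moebius_ppow]), so it changes sign when one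
    exponent is exchanged between d_i - 1 and d_i, whereas for f_i > x_i this
    exchange does not change the truncated sum t + f.  Hence the system is
    triangular and N = 0 ([separation_of_exponents]): x and phi x have the same
    number of coordinates in each unit orbit of R.

    Consequently sum_i g (phi x)_i = sum_i g x_i for every function g that is
    constant on right unit orbits.  R has a generating character chi, that is,
    a character of the additive group whose kernel contains no nonzero left
    ideal: a finite chain ring has one because it has a least nonzero left
    ideal, and generating characters multiply over a product.  For
    g a = sum_u chi (a u), orthogonality of the characters of C turns the
    equality of sums into the equality of the numbers of pairs (i, u) for which
    the i-th coordinate function times u is a prescribed linear function
    ([sum_unit_characters]).  So the coordinate functions of C and of phi
    occupy each orbit under right units equally often, and a bijection between
    them that respects orbits is the required monomial transformation
    ([monomial_extension]). *)

(** * Generating characters *)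

Definition generating_character (R : finUnitRingType) (F : numFieldType)
    (chi : R -> F) : Prop :=
  [/\ chi 0 = 1, {morph chi : x y / x + y >-> x * y}
    & forall a, (forall r, chi (r * a) = 1) -> a = 0].

(** The irreducible characters of a finite abelian group are linear, and their
    kernels intersect trivially. *)
Lemma exists_character_neq1 (A : finZmodType) (a : A) : a != 0 ->
  exists chi : A -> algC,
    [/\ chi 0 = 1, {morph chi : x y / x + y >-> x * y} & chi a != 1].
Proof.
move=> a_neq0.
have lin := char_abelianP _ (FinRing.zmod_abelian [set: A]).
have [i Hi] : exists i, a \notin cfker 'chi[[set: A]]_i.
  apply/existsP; rewrite -negb_forall; apply: contra a_neq0 => /forallP ker_a.
  have : a \in \bigcap_i cfker 'chi[[set: A]]_i.
    by apply/bigcapP=> i _; apply: ker_a.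
  by rewrite TI_cfker_irr inE.
exists 'chi[[set: A]]_i; split.
- exact: lin_char1 (lin i).
- by move=> x y; rewrite -(lin_charM (lin i)) ?inE.
- by move: Hi; rewrite cfkerEirr inE (lin_char1 (lin i)).
Qed.

(** Every nonzero left ideal contains b, so a character that is nontrivial at b
    is nontrivial on every nonzero left ideal. *)
Lemma generating_character_simple_socle (R : finUnitRingType) (b : R) :
  b != 0 -> (forall a, a != 0 -> exists r, r * a = b) ->
  exists chi : R -> algC, generating_character chi.
Proof.
move=> /exists_character_neq1[chi [chi0 chiD chib]] socle.
exists chi; split=> // a chia; apply/eqP; apply: contraNT chib => /socle[r <-].
by rewrite chia.
Qed.

(** A left multiple of a can be concentrated in one factor, so a left ideal in
    the kernel of the product character has all its components in the kernels
    of the factors. *)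
Lemma generating_character_prod (r : nat) (R_ : 'I_r.+1 -> finUnitRingType) :
  (forall i, exists chi : R_ i -> algC, generating_character chi) ->
  exists chi : prodring R_ -> algC, generating_character chi.
Proof.
move=> /fin_all_exists[chi_ chiP].
exists (fun x => \prod_i chi_ i (x i)); split.
- by rewrite big1 // => i _; rewrite mkprodE; case: (chiP i).
- move=> x y; rewrite -big_split; apply: eq_bigr => i _ /=.
  by rewrite mkprodE; case: (chiP i).
- move=> a chia; apply/prodP=> i; rewrite mkprodE.
  have [chi0 _ faithful] := chiP i; apply: faithful => s.
  have := chia (mkprod (dfwith (fun j => 0 : R_ j) s)).
  rewrite (bigD1 i) //= big1 => [|j ji].
    by rewrite mulr1 !mkprodE dfwith_in.
  by rewrite !mkprodE dfwith_out 1?eq_sym // mul0r; case: (chiP j).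
Qed.

(** * Monomial extension over a ring with a generating character *)

Section FrobeniusExtension.
Variables (R : finUnitRingType) (F : numFieldType) (chi : R -> F).
Hypothesis chiP : generating_character chi.
Variables (n : nat) (C : {set 'rV[R]_n}).
Hypothesis C_submod : submod_closed C.
Implicit Types f g : 'rV[R]_n -> R.

Definition linear_on f : Prop :=
  forall a, {in C &, forall x y, f (a *: x + y) = a * f x + f y}.

(** Orthogonality: when f is nonzero on C, translating the sum by a suitable
    multiple of a codeword multiplies it by a value of chi other than 1. *)
Lemma sum_generating_character f : linear_on f ->
  \sum_(x in C) chi (f x) = (#|C| * [forall x in C, f x == 0])%:R.
Proof.
have [chi0 chiD faithful] := chiP; have [_ CZ] := C_submod.
move=> f_lin; case: (boolP [forall x in C, f x == 0]) => [/forall_inP f0|].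
  rewrite muln1 -sum1_card natr_sum; apply: eq_bigr => x Cx.
  by rewrite (eqP (f0 x Cx)) chi0.
rewrite negb_forall_in muln0 => /exists_inP[x0 Cx0 fx0].
have [r chir] : exists r, chi (r * f x0) != 1.
  apply/existsP; rewrite -negb_forall; apply: contra fx0 => /forallP fx0.
  by apply/eqP/faithful => r; apply/eqP.
set S := \sum_(x in C) _; suff /eqP : chi (r * f x0) * S = S.
  rewrite -subr_eq0 -{2}[S]mul1r -mulrBl mulf_eq0 subr_eq0 (negPf chir).
  by move/eqP.
have trans x : (r *: x0 + x \in C) = (x \in C).
  apply/idP/idP => [Cx|]; last exact: CZ.
  have -> : x = (- r) *: x0 + (r *: x0 + x) by rewrite scaleNr addKr.
  exact: CZ.
rewrite /S [RHS](reindex_inj (addrI (r *: x0))) mulr_sumr /=.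
rewrite (eq_bigl _ _ trans); apply: eq_bigr => x Cx.
by rewrite f_lin // chiD.
Qed.

Definition agree f g := [forall x in C, f x == g x].
Definition shift f (u : {unit R}) : 'rV[R]_n -> R := fun x => f x * val u.

Lemma agree_shiftM f g (u v : {unit R}) :
  agree (shift f u) g -> agree (shift f (u * v)%g) (shift g v).
Proof.
move=> /forall_inP fu; apply/forall_inP => x Cx.
by rewrite /shift FinRing.val_unitM mulrA -(eqP (fu x Cx)).
Qed.

Lemma agree_shiftV f g u : agree (shift f u) g = agree f (shift g u^-1%g).
Proof.
apply/forall_inP/forall_inP => H x /H /eqP; rewrite /shift.
  by move<-; rewrite FinRing.val_unitV mulrK // (valP u).
by move->; rewrite FinRing.val_unitV mulrVK // (valP u).
Qed.

(** Functions are cut off outside C so that equality of orbits only depends on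
    the values on C; the set of cut-off functions serves as a canonical name of
    the orbit, by which the coordinates can be counted. *)
Definition orbit_on f : {set {ffun 'rV[R]_n -> R}} :=
  [set [ffun x => if x \in C then shift f u x else 0] | u : {unit R}].

Lemma orbit_onP f g :
  reflect (exists u, agree (shift f u) g) (orbit_on f == orbit_on g).
Proof.
apply: (iffP eqP) => [Efg | [u fu]].
  have : [ffun x => if x \in C then shift g 1%g x else 0] \in orbit_on f.
    by rewrite Efg imset_f.
  case/imsetP=> u _ /ffunP Eu; exists u; apply/forall_inP=> x Cx.
  by have := Eu x; rewrite !ffunE Cx {1}/shift mulr1 => ->.
have sub f1 f2 v : agree (shift f1 v) f2 -> orbit_on f2 \subset orbit_on f1.
  move=> f12; apply/subsetP=> _ /imsetP[s _ ->]; apply/imsetP.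
  exists (v * s)%g => //; apply/ffunP=> x; rewrite !ffunE; case: ifP => // Cx.
  by have /forall_inP/(_ x Cx)/eqP := agree_shiftM s f12.
apply/eqP; rewrite eqEsubset (sub _ _ u^-1%g) ?(sub _ _ u) //.
rewrite agree_shiftV invgK; apply/forall_inP=> x Cx; rewrite eq_sym.
exact: (forall_inP fu).
Qed.

(** The units that carry f to g form a coset of the stabilizer of g. *)
Lemma card_agree_shift f g :
  #|[set u | agree (shift f u) g]| =
    ((orbit_on f == orbit_on g) * #|[set u | agree (shift g u) g]|)%N.
Proof.
case: orbit_onP => [[u fu] | nfg]; last first.
  rewrite mul0n; apply: eq_card0 => u; rewrite inE.
  by apply/negP=> fu; case: nfg; exists u.
rewrite mul1n -[RHS](card_lcoset _ u); apply: eq_card => v.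
rewrite mem_lcoset !inE; apply/idP/idP=> fv.
  apply/forall_inP=> x Cx; have /eqP Eg := forall_inP fu x Cx.
  rewrite /shift -[in eqbLHS]Eg /shift -mulrA.
  by rewrite -FinRing.val_unitM mulKVg; apply: (forall_inP fv).
have := agree_shiftM (u^-1 * v)%g fu; rewrite mulKVg => /forall_inP H.
by apply/forall_inP=> x Cx; rewrite (eqP (H x Cx)); apply: (forall_inP fv).
Qed.

(** The inner sum depends on the values of the fs only through a function that
    is invariant under right units, yet pairing it with the character given by g
    counts how often the orbit of g occurs among the fs. *)
Lemma sum_unit_characters (I : finType) (fs : I -> 'rV[R]_n -> R) g :
  (forall i, linear_on (fs i)) -> linear_on g ->
  \sum_(x in C) chi (- g x) * (\sum_i \sum_(u : {unit R}) chi (fs i x * val u))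
    = (#|C| * (#|[set i | orbit_on (fs i) == orbit_on g]|
        * #|[set u | agree (shift g u) g]|))%:R.
Proof.
have [_ chiD _] := chiP; move=> fs_lin g_lin.
transitivity (\sum_i \sum_(u : {unit R}) \sum_(x in C)
    chi (shift (fs i) u x - g x)).
  rewrite [LHS](eq_bigr (fun x => \sum_i \sum_(u : {unit R})
      chi (shift (fs i) u x - g x))).
    by rewrite exchange_big; apply: eq_bigr => i _; rewrite exchange_big.
  move=> x _; rewrite mulr_sumr; apply: eq_bigr => i _; rewrite mulr_sumr.
  by apply: eq_bigr => u _; rewrite mulrC -chiD.
have cardE (J : finType) (P : pred J) : #|[set j | P j]| = (\sum_j P j)%N.
  by rewrite -sum1dep_card big_mkcond.
rewrite (cardE I) big_distrl big_distrr natr_sum /=; apply: eq_bigr => i _.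
rewrite -card_agree_shift cardE big_distrr natr_sum /=; apply: eq_bigr => u _.
rewrite sum_generating_character => [|a x y Cx Cy]; last first.
  by rewrite /shift fs_lin // g_lin // mulrBr mulrDl mulrA opprD addrACA.
congr (_ * nat_of_bool _)%:R; apply: eq_forallb_in => x Cx.
by rewrite subr_eq0.
Qed.

(** Equality of the sums for all right unit-invariant g gives equality of the
    orbit counts of the coordinate functions, hence a permutation that matches
    the orbits. *)
Theorem monomial_extension (phi : 'rV[R]_n -> 'rV[R]_n) :
  (forall a, {in C &, forall x y, phi (a *: x + y) = a *: phi x + phi y}) ->
  (forall g : R -> F, (forall a (u : {unit R}), g (a * val u) = g a) ->
     {in C, forall x, \sum_i g (phi x 0 i) = \sum_i g (x 0 i)}) ->
  exists (s : 'S_n) (u : 'I_n -> {unit R}),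
    {in C, forall x, phi x = \row_i (x 0 (s i) * val (u i))}.
Proof.
move=> phi_lin phi_inv; have [C0 _] := C_submod.
pose co i (x : 'rV[R]_n) := x 0 i; pose co' i (x : 'rV[R]_n) := phi x 0 i.
have co_lin i : linear_on (co i) by move=> a x y _ _; rewrite /co !mxE.
have co'_lin i : linear_on (co' i).
  by move=> a x y Cx Cy; rewrite /co' phi_lin // !mxE.
have same_count g : linear_on g ->
  #|[set i | orbit_on (co' i) == orbit_on g]|
    = #|[set i | orbit_on (co i) == orbit_on g]|.
  move=> g_lin; apply/eqP.
  have pC : (0 < #|C|)%N by apply/card_gt0P; exists 0.
  have pS : (0 < #|[set u | agree (shift g u) g]|)%N.
    apply/card_gt0P; exists 1%g; rewrite inE; apply/forall_inP=> x Cx.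
    by rewrite /shift mulr1.
  rewrite -(eqn_pmul2r pS) -(eqn_pmul2l pC) -(eqr_nat F).
  rewrite -!sum_unit_characters //; apply/eqP; apply: eq_bigr => x Cx.
  congr (_ * _).
  apply: (phi_inv (fun a => \sum_(u : {unit R}) chi (a * val u))) => // a v.
  rewrite [RHS](reindex_inj (mulgI v)); apply: eq_bigr => u _.
  by rewrite FinRing.val_unitM mulrA.
pose t := [tuple orbit_on (co i) | i < n].
pose t' := [tuple orbit_on (co' i) | i < n].
have countE (h : 'I_n -> 'rV[R]_n -> R) g :
  count_mem (orbit_on g) [tuple orbit_on (h i) | i < n]
    = #|[set i | orbit_on (h i) == orbit_on g]|.
  rewrite count_map -sum1dep_card -sum1_count val_ord_tuple big_enum_cond /=.
  exact: eq_bigl.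
have /tuple_permP[s Es] : perm_eq t' t.
  apply/allP => o; rewrite mem_cat => /orP[]/mapP[i _ ->] /=.
    by rewrite !countE same_count.
  by rewrite !countE same_count.
have Eorb i : exists u, agree (shift (co (s i)) u) (co' i).
  apply/orbit_onP/eqP; have := congr1 (fun q => nth set0 q i) Es.
  by rewrite -!tnth_nth !tnth_mktuple => ->.
have [u uP] := fin_all_exists Eorb.
exists s, u => x Cx; apply/rowP=> i; rewrite mxE.
by have /forall_inP/(_ x Cx)/eqP := uP i.
Qed.
End FrobeniusExtension.

(** * The monoid of exponent vectors and its Moebius function *)

Section ExponentMonoid.
Variables (r : nat) (d : 'I_r.+1 -> nat).
Implicit Types (e f t x y z : exponents d) (i j : 'I_r.+1).

Definition expo e i : nat := (e : {dffun _}) i.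

Lemma expo_le e i : (expo e i <= d i)%N.
Proof. by rewrite -ltnS ltn_ord. Qed.

Lemma expoP e f : (forall i, expo e i = expo f i) -> e = f.
Proof. by move=> E; apply/ffunP=> i; apply/val_inj/E. Qed.

(** Exponents at or above d i are identified with d i, because they all give
    p_i^(d i) = 0. *)
Definition truncate (g : 'I_r.+1 -> nat) : exponents d :=
  [ffun i => inord (minn (d i) (g i))].

Lemma expo_truncate g i : expo (truncate g) i = minn (d i) (g i).
Proof. by rewrite /expo ffunE inordK // ltnS geq_minl. Qed.

Lemma expo_perp e i : expo (perp e) i = (d i - expo e i)%N.
Proof. by rewrite /expo ffunE /= subSS. Qed.

Definition exp_add e f := truncate (fun i => expo e i + expo f i)%N.

Lemma expo_add e f i : expo (exp_add e f) i = minn (d i) (expo e i + expo f i).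
Proof. exact: expo_truncate. Qed.

Definition exp_top := truncate d.

Lemma expo_top i : expo exp_top i = d i.
Proof. by rewrite expo_truncate minnn. Qed.

Definition exp_le e f := [forall i, expo e i <= expo f i]%N.

Lemma exp_nleP e f : ~~ exp_le e f -> exists i, (expo f i < expo e i)%N.
Proof. by rewrite negb_forall => /existsP[j]; rewrite -ltnNge; exists j. Qed.

Lemma exp_neq_top e : e != exp_top -> exists i, (expo e i < d i)%N.
Proof.
move=> e_neq; have /exp_nleP[j] : ~~ exp_le exp_top e.
  apply: contra e_neq => /forallP le_e; apply/eqP/expoP=> i.
  by apply/eqP; rewrite eqn_leq expo_top expo_le -{1}expo_top le_e.
by rewrite expo_top; exists j.
Qed.

(** The Moebius function mu(0, -) at p^k in the chain of ideals of a chain ring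
    of nilpotency index m: larger exponents are smaller ideals, and k = m is the
    zero ideal. *)
Definition chain_mobius (m k : nat) : int :=
  if k == m then 1 else if k.+1 == m then -1 else 0.

Definition exp_mobius e : int := \prod_i chain_mobius (d i) (expo e i).

Lemma exp_mobius_top : exp_mobius exp_top = 1.
Proof.
by rewrite /exp_mobius big1 // => i _; rewrite expo_top /chain_mobius eqxx.
Qed.

Definition swap_nat (k v : nat) : nat :=
  if v == k then k.+1 else if v == k.+1 then k else v.

Lemma swap_natE k v :
  (v = k -> swap_nat k v = k.+1) /\ (v = k.+1 -> swap_nat k v = k) /\
  (v <> k -> v <> k.+1 -> swap_nat k v = v).
Proof. by rewrite /swap_nat; repeat case: eqP => ?; lia. Qed.

Lemma swap_natK k : involutive (swap_nat k).
Proof.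
move=> v; rewrite /swap_nat; case: (v =P k) => [->|nvk].
  by rewrite -[k in _ == k]addn0 -addn1 eqn_add2l eqxx.
by case: (v =P k.+1) => [->|nvk1]; [rewrite eqxx | repeat case: eqP].
Qed.

Definition swap_at i k e :=
  truncate (fun j => if j == i then swap_nat k (expo e j) else expo e j).

Lemma expo_swap_at i k e j : (k < d i)%N ->
  expo (swap_at i k e) j
    = if j == i then swap_nat k (expo e j) else expo e j.
Proof.
move=> ltk; rewrite expo_truncate; have := expo_le e j; case: eqP => [->|_].
  by rewrite /swap_nat; case: ifP => _; first lia; case: ifP => _; lia.
lia.
Qed.

Lemma swap_atK i k : (k < d i)%N -> involutive (swap_at i k).
Proof.
move=> ltk e; apply: expoP => j; rewrite !expo_swap_at //.
by case: (j == i); rewrite ?swap_natK.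
Qed.

(** A swap-invariant domain and a swap-antisymmetric summand make the sum equal
    to its opposite. *)
Lemma sum_swap_eq0 (F : numDomainType) i k (D : pred (exponents d))
    (G : exponents d -> F) :
  (k < d i)%N -> (forall t, D t -> D (swap_at i k t)) ->
  (forall t, D t -> G (swap_at i k t) = - G t) -> \sum_(t | D t) G t = 0.
Proof.
move=> ltk Dswap Gswap; apply/eqP; rewrite -eqNr -sumrN; apply/eqP.
rewrite [RHS](reindex_inj (inv_inj (swap_atK ltk))).
apply: eq_big => [t | t Dt]; last by rewrite Gswap.
by apply/idP/idP=> [|/Dswap]; [apply: Dswap | rewrite swap_atK].
Qed.

Lemma exp_mobius_flip i e f : (forall j, j != i -> expo f j = expo e j) ->
  chain_mobius (d i) (expo f i) = - chain_mobius (d i) (expo e i) ->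
  exp_mobius f = - exp_mobius e.
Proof.
move=> Eef Ei; rewrite /exp_mobius (bigD1 i) //= Ei mulNr [in RHS](bigD1 i) //=.
by congr (- (_ * _)); apply: eq_bigr => j /Eef ->.
Qed.

(** This is the recursion that characterizes mu(0, -).  At a coordinate where
    y is not maximal, the exponents d i - 1 and d i contribute opposite signs,
    and all others contribute 0. *)
Lemma sum_exp_mobius_ge y : y != exp_top ->
  \sum_(z | exp_le y z) exp_mobius z = 0.
Proof.
move=> /exp_neq_top[i lty]; have ltk : ((d i).-1 < d i)%N by lia.
apply: (@sum_swap_eq0 _ i _ _ _ ltk) => z /forallP le_yz.
  apply/forallP=> j; rewrite expo_swap_at //.
  have := le_yz j; case: (j =P i) => [->|//].
  have := swap_natE (d i).-1 (expo z i); lia.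
apply: (exp_mobius_flip (i := i)) => [j ji|].
  by rewrite expo_swap_at // (negPf ji).
rewrite expo_swap_at // eqxx /chain_mobius.
have := swap_natE (d i).-1 (expo z i); have := expo_le z i.
by repeat case: eqP => ?; lia.
Qed.

Variables (F : numDomainType) (W : exponents d -> F).

(** At f = x this is the sum of the main hypothesis, written with exponent
    vectors; as a function of f it is a linear combination of the translates
    of W. *)
Definition mobius_transform x f : F :=
  \sum_(t | exp_le t (perp x))
     (exp_mobius (exp_add x t))%:~R * W (exp_add t f).

(** If x_i < f_i, exchanging t_i between d_i - 1 - x_i and d_i - x_i flips the
    sign of the Moebius factor, while t_i + f_i is at least d_i in both cases,
    so that the truncated sum stays the same. *)
Lemma mobius_transform_eq0 x f : ~~ exp_le f x -> mobius_transform x f = 0.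
Proof.
move=> /exp_nleP[i ltxf]; have le_f := expo_le f i.
have ltk : ((d i).-1 - expo x i < d i)%N by lia.
apply: (@sum_swap_eq0 _ i _ _ _ ltk) => t /forallP le_t.
  apply/forallP=> j; rewrite expo_swap_at //.
  have := le_t j; rewrite !expo_perp; case: (j =P i) => [->|//].
  have := swap_natE ((d i).-1 - expo x i) (expo t i); lia.
have := le_t i; rewrite expo_perp => le_ti.
rewrite -mulNr -mulrNz; congr (_%:~R * W _).
  apply: (exp_mobius_flip (i := i)) => [j ji|].
    by rewrite !expo_add expo_swap_at // (negPf ji).
  rewrite !expo_add expo_swap_at // eqxx /chain_mobius.
  have := swap_natE ((d i).-1 - expo x i) (expo t i).
  repeat case: eqP => ?; lia.
apply: expoP => j; rewrite !expo_add expo_swap_at //.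
case: (j =P i) => // ->.
have := swap_natE ((d i).-1 - expo x i) (expo t i); lia.
Qed.

(** The functionals f |-> mobius_transform x f form a triangular system with
    nonzero diagonal, solved by induction on the total degree of x; the value at
    [exp_top] is then forced by the vanishing of the total sum. *)
Theorem separation_of_exponents (N : exponents d -> F) :
  (forall x, x != exp_top -> mobius_transform x x != 0) ->
  \sum_f N f = 0 ->
  (forall t, \sum_f N f * W (exp_add t f) = 0) ->
  forall f, N f = 0.
Proof.
move=> T_neq0 sumN NW.
have N_eq0 x : x != exp_top -> N x = 0.
  have [m] := ubnP (\sum_i expo x i)%N; elim: m x => // m IHm x lt_xm x_ntop.
  have : \sum_f N f * mobius_transform x f = 0.
    rewrite (eq_bigr (fun f => \sum_(t | exp_le t (perp x))
        (exp_mobius (exp_add x t))%:~R * (N f * W (exp_add t f)))) => [|f _].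
      rewrite exchange_big big1 // => t _.
      by rewrite -mulr_sumr NW mulr0.
    rewrite /mobius_transform mulr_sumr.
    by apply: eq_bigr => t _; rewrite mulrCA.
  (* Other terms vanish: mobius_transform x f is 0 unless f <= x, and N f is 0
     by induction when f <= x and f != x. *)
  rewrite (bigD1 x) //= big1 => [/eqP|f f_neq].
    by rewrite addr0 mulf_eq0 (negPf (T_neq0 x x_ntop)) orbF => /eqP.
  have [/forallP le_fx | nle] := boolP (exp_le f x); last first.
    by rewrite mobius_transform_eq0 ?mulr0.
  have [i lt_fx] : exists i, (expo f i < expo x i)%N.
    apply/exp_nleP; apply: contra f_neq => /forallP le_xf.
    by apply/eqP/expoP=> i; apply/eqP; rewrite eqn_leq le_fx le_xf.
  rewrite IHm ?mul0r //.
    apply: leq_trans (ltnSE lt_xm).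
    rewrite (bigD1 i) //= [ltnRHS](bigD1 i) //= -addSn leq_add //.
    by apply: leq_sum => j _; apply: le_fx.
  apply: contraTneq lt_fx => ->.
  by rewrite expo_top -leqNgt expo_le.
move=> f; case: (eqVneq f exp_top) => [-> | /N_eq0 //].
by rewrite -sumN (bigD1 exp_top) //= big1 ?addr0.
Qed.
End ExponentMonoid.

(** * Finite chain rings *)

Section LeftIdeals.
Variable A : finUnitRingType.
Implicit Types a b x : A.

(** Multiplication by a left invertible element is injective, hence surjective
    on a finite ring. *)
Lemma left_invertible_unit a b : b * a = 1 -> a \is a GRing.unit.
Proof.
move=> ba1; have inj_a : injective ( *%R a).
  by apply: (can_inj (g := *%R b)) => x; rewrite mulrA ba1 mul1r.
have [c _ ac1] := injF_bij inj_a.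
apply/unitrP; exists b; split=> //.
have c1 : c 1 = b by rewrite -[c 1]mul1r -{1}ba1 -mulrA ac1 mulr1.
by rewrite -[RHS](ac1 1) c1.
Qed.

Lemma lidealP x y : reflect (exists a, x = a * y) (x \in lideal y).
Proof. by apply: (iffP imsetP) => [[a _ ->]|[a ->]]; exists a. Qed.

Lemma left_ideal_lideal x : left_ideal (lideal x).
Proof.
apply/and3P; split.
- by apply/lidealP; exists 0; rewrite mul0r.
- apply/forall_inP=> _ /lidealP[a ->]; apply/forall_inP=> _ /lidealP[b ->].
  by apply/lidealP; exists (a + b); rewrite mulrDl.
- apply/forallP=> a; apply/forall_inP=> _ /lidealP[b ->].
  by apply/lidealP; exists (a * b); rewrite mulrA.
Qed.

Lemma lideal_subset x y : (lideal x \subset lideal y) = (x \in lideal y).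
Proof.
apply/subsetP/lidealP => [sub | [a ->] _ /lidealP[b ->]].
  by apply/lidealP/sub/lidealP; exists 1; rewrite mul1r.
by apply/lidealP; exists (b * a); rewrite mulrA.
Qed.

Lemma lideal_unitM u x : u \is a GRing.unit -> lideal (u * x) = lideal x.
Proof.
move=> Uu; apply/eqP; rewrite eqEsubset !lideal_subset; apply/andP; split.
  by apply/lidealP; exists u.
by apply/lidealP; exists u^-1; rewrite mulKr.
Qed.
End LeftIdeals.

Section ChainRing.
Variables (A : finUnitRingType) (p : A) (d : nat).
Hypotheses (chainA : chain_ring A) (radA : jacobson A = lideal p).
Hypothesis (nilA : nilpotency_index (jacobson A) d).
Implicit Types a b u v : A.

(** The left ideals form a chain, so there is only one maximal left ideal, and
    it contains every proper principal left ideal. *)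
Lemma jacobson_nonunits a : (a \in jacobson A) = (a \isn't a GRing.unit).
Proof.
set P := fun I : {set A} => left_ideal I && (I != setT).
have P_lideal b : b \isn't a GRing.unit -> P (lideal b).
  move=> nUb; rewrite /P left_ideal_lideal /=; apply: contra nUb => /eqP E.
  have /lidealP[c /esym] : 1 \in lideal b by rewrite E inE.
  exact: left_invertible_unit.
apply/idP/idP=> [/bigcapP aJ | nUa].
  have [M maxM _] := maxset_exists (P_lideal 0 (negbT (unitr0 A))).
  have aM := aJ M maxM; apply/negP=> Ua.
  have /andP[/and3P[_ _ /forallP Mmul] /eqP[]] := maxsetp maxM.
  apply/setP=> b; rewrite inE.
  have /forall_inP/(_ a aM) := Mmul (b * a^-1).
  by rewrite mulrVK.
have [M maxM /subsetP sub] := maxset_exists (P_lideal a nUa).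
apply/bigcapP=> M' maxM'.
have aM : a \in M by apply: sub; apply/lidealP; exists 1; rewrite mul1r.
have /andP[idM _] := maxsetp maxM; have /andP[idM' _] := maxsetp maxM'.
case/orP: (chainA.1 _ _ idM idM') => [/subsetP -> // | subM].
by rewrite -(maxsetsup maxM' (maxsetp maxM) subM).
Qed.

Lemma nonunit_multiple a : a \isn't a GRing.unit -> exists b, a = b * p.
Proof. by rewrite -jacobson_nonunits radA => /lidealP. Qed.

Lemma generator_nonunit a : a * p \isn't a GRing.unit.
Proof. by rewrite -jacobson_nonunits radA; apply/lidealP; exists a. Qed.

Lemma nonunitMr a b : a \isn't a GRing.unit -> a * b \isn't a GRing.unit.
Proof.
apply: contra => Uab.
have abK : a * (b * (a * b)^-1) = 1 by rewrite mulrA divrr.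
have Ub := left_invertible_unit abK.
apply/unitrP; exists (b * (a * b)^-1); split=> //; apply: (mulIr Ub).
by rewrite -mulrA abK mulr1 mul1r.
Qed.

(** Nakayama for one element: 1 - a is a unit when a is in the radical. *)
Lemma eq_nonunitM_0 a x : a \isn't a GRing.unit -> x = a * x -> x = 0.
Proof.
move=> nUa Ex; have /unitrP[c [c1 _]] : 1 - a \is a GRing.unit.
  apply: contraLR isT => nU1a; have [b Eb] := nonunit_multiple nUa.
  have [c Ec] := nonunit_multiple nU1a.
  have := generator_nonunit (b + c).
  by rewrite mulrDl -Eb -Ec addrC subrK unitr1.
by rewrite -[x]mul1r -c1 -mulrA mulrBl mul1r -Ex subrr mulr0.
Qed.

Lemma generator_nilpotent : p ^+ d = 0.
Proof.
have /(_ (fun=> p)) := nilA.1; rewrite prodr_const card_ord; apply=> i.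
by rewrite radA; apply/lidealP; exists 1; rewrite mul1r.
Qed.

(** Since p a is always a left multiple of p, a product of k elements of the
    radical is a left multiple of p^k; so p^k = 0 would make the k-th power of
    the radical vanish. *)
Lemma pow_generator_neq0 k : (k < d)%N -> p ^+ k != 0.
Proof.
move=> ltkd; apply: contraTneq ltkd => pk0; rewrite -leqNgt; apply: nilA.2.
have comm a m : exists b, p ^+ m * a = b * p ^+ m.
  elim: m a => [|m IHm] a; first by exists a; rewrite mulr1 mul1r.
  have pa : p * a \isn't a GRing.unit.
    by apply: nonunitMr; have := generator_nonunit 1; rewrite mul1r.
  have [b Eb] := nonunit_multiple pa; have [c Ec] := IHm b.
  by exists c; rewrite exprSr -mulrA Eb mulrA Ec mulrA.
move=> x xJ; suff [c ->] : exists c, \prod_(i < k) x i = c * p ^+ k.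
  by rewrite pk0 mulr0.
elim: {pk0} k x xJ => [|k IHk] x xJ.
  by exists 1; rewrite big_ord0 mul1r.
have [c Ec] := IHk (fun i => x (widen_ord (leqnSn k) i)) (fun i => xJ _).
have := xJ ord_max; rewrite radA => /lidealP[b Eb].
have [b' Eb'] := comm b k; exists (c * b').
by rewrite big_ord_recr /= Ec Eb mulrA -[c * _ * b]mulrA Eb' exprSr !mulrA.
Qed.

Lemma nilpotency_gt0 : (0 < d)%N.
Proof.
by case: d generator_nilpotent => // /eqP; rewrite expr0 oner_eq0.
Qed.

(** If p^k = b p^m with k < m, then p^k is a radical element times p^k, so it
    vanishes. *)
Lemma pow_generator_lideal k m :
  (k <= d)%N -> (m <= d)%N -> (p ^+ k \in lideal (p ^+ m)) = (m <= k)%N.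
Proof.
move=> lekd lemd; apply/lidealP/idP => [[b Eb] | lemk].
  rewrite leqNgt; apply/negP=> ltkm.
  have /eqP[] := pow_generator_neq0 (leq_trans ltkm lemd).
  apply: (@eq_nonunitM_0 (b * p ^+ (m - k).-1 * p)).
    exact: generator_nonunit.
  by rewrite {1}Eb -!mulrA -exprS -exprD; congr (_ * _ ^+ _); lia.
by exists (p ^+ (k - m)); rewrite -exprD subnK.
Qed.

(** Divide by p on the right until the quotient is a unit; after d divisions
    the element is 0. *)
Lemma chain_factorization a :
  exists (k : 'I_d.+1) (u : {unit A}), a = val u * p ^+ k.
Proof.
suff [[k [u [lekd Uu ->]]] | [b ->]] :
    (exists k u, [/\ (k <= d)%N, u \is a GRing.unit & a = u * p ^+ k])
    \/ exists b, a = b * p ^+ d.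
- by exists (inord k), (FinRing.Unit Uu); rewrite inordK.
- by exists ord_max, 1%g; rewrite generator_nilpotent !mulr0.
elim: {1 4}d (leqnn d) => [|m IHm] lemd.
  by right; exists a; rewrite expr0 mulr1.
have [? | [b Eb]] := IHm (ltnW lemd); first by left.
case: (boolP (b \is a GRing.unit)) => [Ub | /nonunit_multiple[c Ec]].
  by left; exists m, b; split=> //; apply: ltnW.
by right; exists c; rewrite Eb Ec -mulrA exprS.
Qed.

(** The right ideals u p A and p A are comparable and have the same size, hence
    are equal, so u p = p v for some v; a nonunit v would force p = 0. *)
Lemma unitM_generator u : u \is a GRing.unit ->
  exists2 v, v \is a GRing.unit & u * p = p * v.
Proof.
move=> Uu; pose I x : {set A} := [set x * a | a : A].
have idI x : right_ideal (I x).
  apply/and3P; split.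
  - by apply/imsetP; exists 0; rewrite ?mulr0.
  - apply/forall_inP=> _ /imsetP[a _ ->]; apply/forall_inP=> _ /imsetP[b _ ->].
    by apply/imsetP; exists (a + b); rewrite ?mulrDr.
  - apply/forallP=> a; apply/forall_inP=> _ /imsetP[b _ ->].
    by apply/imsetP; exists (b * a); rewrite ?mulrA.
have cardI : #|I (u * p)| = #|I p|.
  rewrite -(card_imset (I p) (mulrI Uu)); apply: eq_card => x.
  apply/imsetP/imsetP=> [[a _ ->] | [_ /imsetP[a _ ->] ->]].
    by exists (p * a); rewrite ?mulrA //; apply/imsetP; exists a.
  by exists a; rewrite ?mulrA.
have EI : I (u * p) = I p.
  apply/eqP; case/orP: (chainA.2 _ _ (idI (u * p)) (idI p)) => sub.
    by rewrite eqEcard sub cardI /=.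
  by rewrite eq_sym eqEcard sub cardI /=.
have /imsetP[v _ Ev] : u * p \in I p.
  by rewrite -EI; apply/imsetP; exists 1; rewrite ?mulr1.
case: (boolP (v \is a GRing.unit)) => [Uv | /nonunit_multiple[c Ec]].
  by exists v.
have p0 : p = 0.
  apply: (@eq_nonunitM_0 (u^-1 * p * c)); last by rewrite -!mulrA -Ec -Ev mulKr.
  by apply: nonunitMr; apply: generator_nonunit.
by exists 1; rewrite ?unitr1 // p0 mul0r mulr0.
Qed.

Lemma unitM_pow_generator k (u : {unit A}) :
  exists v : {unit A}, val u * p ^+ k = p ^+ k * val v.
Proof.
elim: k u => [|k IHk] u; first by exists u; rewrite mul1r mulr1.
have [v Ev] := IHk u; have [v' Uv' Ev'] := unitM_generator (valP v).
exists (FinRing.Unit Uv'); rewrite exprSr mulrA Ev.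
by rewrite -mulrA Ev' mulrA.
Qed.

(** Every nonzero left ideal contains the last nonzero power of p. *)
Lemma chain_generating_character :
  exists chi : A -> algC, generating_character chi.
Proof.
have d_gt0 := nilpotency_gt0.
apply: (@generating_character_simple_socle _ (p ^+ d.-1)).
  by apply: pow_generator_neq0; rewrite prednK.
move=> a a_neq0; have [k [u Ea]] := chain_factorization a.
have ltkd : (k < d)%N.
  rewrite ltn_neqAle -ltnS ltn_ord andbT; apply: contraNneq a_neq0 => Ek.
  by rewrite Ea Ek generator_nilpotent mulr0.
exists (p ^+ (d.-1 - k) * (val u)^-1).
rewrite Ea -mulrA mulKr ?(valP u) // -exprD; congr (_ ^+ _); lia.
Qed.
End ChainRing.

(** * Products of finite chain rings *)

Section ChainRingProduct.
Variables (r : nat) (R_ : 'I_r.+1 -> finUnitRingType).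
Variables (p : forall i, R_ i) (d : 'I_r.+1 -> nat).
Hypothesis chainR : forall i, chain_ring (R_ i).
Hypothesis radR : forall i, jacobson (R_ i) = lideal (p i).
Hypothesis nilR : forall i, nilpotency_index (jacobson (R_ i)) (d i).
Local Notation R := (prodring R_).
Implicit Types (a b : R) (e f t x y z : exponents d).

Lemma mem_lideal_prod a b :
  (a \in lideal b) = [forall i, a i \in lideal (b i)].
Proof.
apply/lidealP/forallP=> [[c ->] i | /(_ _)/lidealP cP].
  by apply/lidealP; exists (c i); rewrite mkprodE.
have [c Ec] := fin_all_exists cP; exists (mkprod c).
by apply/prodP=> i; rewrite !mkprodE.
Qed.

Lemma ppowE e i : ppow p e i = p i ^+ expo e i.
Proof. exact: mkprodE. Qed.

Lemma lideal_ppow_subset e f :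
  (lideal (ppow p e) \subset lideal (ppow p f)) = exp_le f e.
Proof.
rewrite lideal_subset mem_lideal_prod; apply: eq_forallb => i.
rewrite !ppowE.
apply: (pow_generator_lideal (chainR i) (radR i) (nilR i));
  exact: expo_le.
Qed.

Lemma lideal_ppow_inj : injective (fun e => lideal (ppow p e)).
Proof.
move=> e f /eqP; rewrite eqEsubset !lideal_ppow_subset.
move=> /andP[/forallP le_fe /forallP le_ef]; apply: expoP => i.
by apply/eqP; rewrite eqn_leq le_fe le_ef.
Qed.

Lemma ppow_inj : injective (ppow p (d := d)).
Proof. by move=> e f E; apply: lideal_ppow_inj; rewrite /= E. Qed.

Lemma pow_generator_min i k : p i ^+ minn (d i) k = p i ^+ k.
Proof.
case: leqP => // le_dk.
by rewrite -(subnK le_dk) exprD (generator_nilpotent (radR i) (nilR i)) mulr0.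
Qed.

Lemma ppow_add e f : ppow p (exp_add e f) = ppow p e * ppow p f.
Proof.
apply/prodP=> i; rewrite ppowE [RHS]mkprodE !ppowE expo_add.
by rewrite pow_generator_min exprD.
Qed.

Lemma ppow_top : ppow p (exp_top d) = 0.
Proof.
apply/prodP=> i.
by rewrite ppowE expo_top (generator_nilpotent (radR i) (nilR i)) mkprodE.
Qed.

Definition prod_Unit (u : forall i, {unit R_ i}) : {unit R}.
Proof.
exists (mkprod (fun i => val (u i))).
by apply/forallP=> i; rewrite mkprodE (valP (u i)).
Defined.

Lemma left_factorization a :
  exists e (u : {unit R}), a = val u * ppow p e.
Proof.
have [k /fin_all_exists[u E]] :=
  fin_all_exists
    (fun i => chain_factorization (chainR i) (radR i) (nilR i) (a i)).
exists [ffun i => k i], (prod_Unit u); apply/prodP=> i.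
by rewrite !mkprodE ffunE.
Qed.

Lemma right_factorization a :
  exists e (u : {unit R}), a = ppow p e * val u.
Proof.
have [e [u ->]] := left_factorization a; exists e.
have comm i : exists v : {unit R_ i},
    val u i * p i ^+ expo e i = p i ^+ expo e i * val v.
  have Ui : val u i \is a GRing.unit by have /forallP := valP u; apply.
  exact: (unitM_pow_generator (chainR i) (radR i) _ (FinRing.Unit Ui)).
have [v Ev] := fin_all_exists comm; exists (prod_Unit v).
by apply/prodP=> i; rewrite !mkprodE; apply: Ev.
Qed.

Lemma principal_lidealsE :
  principal_lideals R = [set lideal (ppow p e) | e : exponents d].
Proof.
apply/setP=> I; apply/imsetP/imsetP=> [[a _ ->] | [e _ ->]]; last first.
  by exists (ppow p e).
have [e [u ->]] := left_factorization a; exists e => //.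
by rewrite lideal_unitM // (valP u).
Qed.

(** The poset of principal left ideals is the poset of exponent vectors with the
    order reversed, and [exp_mobius] satisfies the recursion that defines the
    Moebius function. *)
Lemma moebius_ppow y :
  moebius (principal_lideals R) (lideal 0) (lideal (ppow p y)) = exp_mobius y.
Proof.
rewrite -ppow_top.
have [m] := ubnP #|[set z | exp_le y z]|.
elim: m y => // m IHm y lt_ym.
have [->|y_ntop] := eqVneq y (exp_top d).
  by rewrite moebius_refl exp_mobius_top.
have sub_top z : lideal (ppow p (exp_top d)) \subset lideal (ppow p z).
  by rewrite lideal_ppow_subset; apply/forallP=> i; rewrite expo_top expo_le.
rewrite moebius_lt; last first.
  rewrite properEneq sub_top andbT (inj_eq lideal_ppow_inj).
  by rewrite eq_sym.
rewrite principal_lidealsE big_mkcondr big_imset /=; last first.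
  by move=> e f _ _; apply: lideal_ppow_inj.
have := sum_exp_mobius_ge y_ntop; rewrite (bigD1 y) /=; last first.
  by apply/forallP=> i.
move/eqP; rewrite addr_eq0 => /eqP ->; congr (- _).
rewrite [RHS]big_mkcond /=; apply: eq_bigr => z _.
rewrite sub_top /= properEneq (inj_eq lideal_ppow_inj) lideal_ppow_subset andbC.
case: ifP => // /andP[le_yz z_neq]; rewrite -principal_lidealsE; apply: IHm.
apply: leq_trans (ltnSE lt_ym); apply: proper_card; apply/properP; split.
  apply/subsetP=> t; rewrite !inE => /forallP le_zt; apply/forallP=> i.
  exact: leq_trans (forallP le_yz i) (le_zt i).
exists y; rewrite !inE; first by apply/forallP=> i.
apply: contra z_neq => /forallP le_zy; apply/eqP/expoP=> i; apply/eqP.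
by rewrite eqn_leq le_zy (forallP le_yz i).
Qed.

(** The weight enters only through an equality of coordinate counts, which are
    natural numbers; so its values may lie in any number field, unrelated to the
    algebraic numbers in which the generating character takes its values. *)
Theorem product_macwilliams (F : numFieldType) (w : R -> F) :
  invariant_weight w ->
  (forall x : exponents d, ppow p x != 0 ->
     \sum_(t in representatives p d | lideal (ppow p (perp x)) \subset lideal t)
        (moebius (principal_lideals R)
           (lideal 0) (lideal (ppow p x * t)))%:~R
        * w (t * ppow p x) != 0) ->
  MacWilliams_equivalence w.
Proof.
move=> [w0 w_unit] sum_neq0 n _ C C_submod phi [phi_lin phi_w].
pose W (e : exponents d) := w (ppow p e).
have W_neq0 x : x != exp_top d -> mobius_transform W x x != 0.
  move=> x_ntop.
  have x_neq0 : ppow p x != 0 by rewrite -ppow_top (inj_eq ppow_inj).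
  have := sum_neq0 x x_neq0; rewrite big_mkcondr big_imset /=; last first.
    by move=> e f _ _; apply: ppow_inj.
  apply: contraNneq => E; apply/eqP; rewrite -[RHS]E [RHS]big_mkcond /=.
  apply: eq_bigr => t _; rewrite lideal_ppow_subset; case: ifP => // _.
  by rewrite -!ppow_add moebius_ppow.
have [v vP] := fin_all_exists right_factorization.
have wW t a : w (ppow p t * a) = W (exp_add t (v a)).
  have [u {1}->] := vP a; rewrite mulrA -ppow_add /W.
  by have [_ <-] := w_unit (ppow p (exp_add t (v a))) _ (valP u).
have same_count (x : 'rV_n) e : x \in C ->
    #|[set i | v (phi x 0 i) == e]| = #|[set i | v (x 0 i) == e]|.
  move=> Cx; apply/eqP; rewrite -(eqr_nat F) -subr_eq0; apply/eqP.
  pose N f : F := #|[set i | v (phi x 0 i) == f]|%:R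
                  - #|[set i | v (x 0 i) == f]|%:R.
  have sumN (G : exponents d -> F) : \sum_f N f * G f
      = \sum_i G (v (phi x 0 i)) - \sum_i G (v (x 0 i)).
    have sumE (h : 'I_n -> exponents d) :
        \sum_i G (h i) = \sum_f #|[set i | h i == f]|%:R * G f.
      rewrite (partition_big h xpredT) //=; apply: eq_bigr => f _.
      rewrite (eq_bigr (fun=> G f)) => [|i /eqP -> //].
      by rewrite sumr_const mulr_natl cardsE.
    by rewrite !sumE -sumrB; apply: eq_bigr => f _; rewrite mulrBl.
  apply: (separation_of_exponents (W := W) (N := N)) => // [|t].
    rewrite (eq_bigr (fun f => N f * 1)) => [|f _]; last by rewrite mulr1.
    by rewrite sumN subrr.
  rewrite sumN; have [C0 CZ] := C_submod.
  have Ctx : ppow p t *: x \in C.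
    by rewrite -[_ *: x]addr0; apply: CZ.
  have phi0 : phi 0 = 0.
    have := phi_lin (-1) 0 0 C0 C0.
    by rewrite scaler0 addr0 scaleN1r addNr.
  have phiZ : phi (ppow p t *: x) = ppow p t *: phi x.
    by rewrite -[_ *: x]addr0 phi_lin // phi0 addr0.
  have := phi_w _ Ctx; rewrite phiZ /weight => Ew.
  apply/eqP; rewrite subr_eq0; apply/eqP.
  transitivity (\sum_i w ((ppow p t *: phi x) 0 i)).
    by apply: eq_bigr => i _; rewrite mxE wW.
  by rewrite Ew; apply: eq_bigr => i _; rewrite mxE wW.
have [chi chiP] : exists chi : R -> algC, generating_character chi.
  apply: generating_character_prod => i.
  exact: chain_generating_character (chainR i) (radR i) (nilR i).
have [//|s [u Esu]] := monomial_extension chiP C_submod phi_lin.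
  move=> g g_unit x Cx.
  have gE a : g a = g (ppow p (v a)).
    by have [u {1}->] := vP a; rewrite g_unit.
  have sumE (h : 'I_n -> R) :
      \sum_i g (h i) = \sum_e g (ppow p e) *+ #|[set i | v (h i) == e]|.
    rewrite (partition_big (fun i => v (h i)) xpredT) //=.
    apply: eq_bigr => e _; rewrite cardsE -sumr_const.
    by apply: eq_bigr => i /eqP <-; apply: gE.
  by rewrite !sumE; apply: eq_bigr => e _; rewrite same_count.
exists (fun x : 'rV[R]_n => \row_i (x 0 (s i) * val (u i))); split; last first.
  by move=> x Cx; rewrite Esu.
exists s, u; split=> // i; rewrite inE; apply/forallP=> x.
by have [_ <-] := w_unit x _ (valP (u i)).
Qed.
End ChainRingProduct.

Theorem theorem5p8 (K : realType) (r : nat) (R_ : 'I_r.+1 -> finUnitRingType)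
  (p : forall i, R_ i) (d : 'I_r.+1 -> nat)
  (chainR : forall i, chain_ring (R_ i))
  (radR : forall i, jacobson (R_ i) = lideal (p i))
  (nilR : forall i, nilpotency_index (jacobson (R_ i)) (d i))
  (w : prodring R_ -> K[i]) (winv : invariant_weight w) :
  (forall x : exponents d, ppow p x != 0 ->
     \sum_(t in representatives p d | lideal (ppow p (perp x)) \subset lideal t)
        (moebius (principal_lideals (prodring R_))
           (lideal 0) (lideal (ppow p x * t)))%:~R
        * w (t * ppow p x) != 0) ->
  MacWilliams_equivalence w.
Proof. exact: (product_macwilliams chainR radR nilR winv). Qed.
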